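(* Let $n\ge 2$ and let $M$ be an $(n-1)$-connected $(2n+1)$-manifold with $H_n(M)\cong \mathbb{Z}^r\oplus G$, $G$ finite abelian and $r\ge 1$. Let $$q_M(t)=1-rt^{n-1}-rt^{n}+t^{2n-1},\qquad \eta_m:=\text{coefficient of } t^m \text{ in } \log(q_M(t)).$$ For each $m\geq 2$, the number of groups $\pi_s (S^m)\otimes D_M$ in $\pi_s(M)\otimes D_M$ (i.e. the number of indices $i$ with $h_i=m$ in the decomposition $\pi_s(M)\otimes D_M\cong\bigoplus_{i\ge1}\pi_s(S^{h_i})\otimes D_M$ described in the context) is $$l_{m-1}= - \sum_{j\mid m-1} \mu(j)\,\frac{\eta_{(m-1)/j}}{j},$$ where $\mu$ is the Möbius function.
   Context: All manifolds are compact, closed and oriented. By Poincaré duality, $H_i(M)=\mathbb{Z}$ for $i=0,2n+1$; $H_n(M)=\mathbb{Z}^r\oplus G$; $H_{n+1}(M)=\mathbb{Z}^r$; $H_i(M)=0$ otherwise, with $G$ finite abelian. $\Sigma_M$ is the finite set of primes $p$ with $G\otimes\mathbb{Z}/p\neq0$ and $D_M=\mathbb{Z}[\frac1p:p\in\Sigma_M]\subset\mathbb{Q}$. The integers $h_i$: let $\mathcal{L}(M)$ be the (ungraded, i.e. without Koszul signs) Lie algebra over $D_M$ given by the free Lie algebra on $u_1,\dots,u_r,u_1',\dots,u_r'$ modulo the Lie ideal generated by $\sum_i[u_i,u_i']$, with the grading $|u_i|=n-1$, $|u_i'|=n$. Order the letters totally with $u_1<u_1'$ the two smallest. A Lyndon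 word is a word lexicographically strictly smaller than its nontrivial cyclic rearrangements; a Lyndon word $l$ of length $>1$ factors uniquely as $l=l'l''$ with $l',l''$ Lyndon and $l''$ the longest proper Lyndon right factor, and one sets $b(a)=a$ for letters and $b(l)=[b(l'),b(l'')]$. The elements $b(l)$, for $l$ a Lyndon word not containing $u_1u_1'$ consecutively in that order, form a $D_M$-basis of $\mathcal{L}(M)$. List these Lyndon words as $l_1,l_2,\dots$ (finite or infinite) with nondecreasing heights, where the height of $l_i$ is $h_i=w+1$ if $b(l_i)$ has degree $w$. The decomposition $\pi_s(M)\otimes D_M\cong\bigoplus_{i\ge1}\pi_s(S^{h_i})\otimes D_M$ is the one induced by maps $\lambda_i:S^{h_i}\to M$, which are the iterated Whitehead products obtained from $b(l_i)$ by replacing $u_j$, $u_j'$ by maps $\nu_j:S^n\to M$, $\nu_j':S^{n+1}\to M$. Here the Hurewicz images $v_j$ of $\nu_j$ and $v_j'$ of $\nu_j'$ form bases, modulo torsion, of $H_n(M)$ and $H_{n+1}(M)$ whose dual cohomology classes $w_j,w_j'$ satisfy $\langle w_iw_j',[M]\rangle=\delta_{ij}$. *)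

(* Defs.v *)
From HB Require Import structures.
From mathcomp Require Import all_boot all_order all_algebra finmap.
From mathcomp.multinomials Require Import freeg.
From mathcomp Require Import all_classical reals topology normedtype.
From mathcomp Require Import ring.

Set Implicit Arguments.
Unset Strict Implicit.
Unset Printing Implicit Defensive.

Import Order.TTheory GRing.Theory Num.Theory numFieldNormedType.Exports.

Local Open Scope classical_set_scope.
Local Open Scope ring_scope.

(* The additive extension of f to the free abelian group on K *)
Definition fgsum (K : choiceType) (V : zmodType) (f : K -> V)
  (c : {freeg K}) : V := fglift (f : K -> zmodule V) c.

Lemma fgsum_is_zmod_morphism (K : choiceType) (V : zmodType) (f : K -> V) :
  zmod_morphism (fgsum f).
Proof. exact: (@lift_is_additive _ _ (zmodule V)). Qed.

HB.instance Definition _ (K : choiceType) (V : zmodType) (f : K -> V) :=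
  GRing.isZmodMorphism.Build {freeg K} V (fgsum f) (fgsum_is_zmod_morphism f).

Definition fgen (K : choiceType) (k : K) : {freeg K} := Freeg [:: (1%:Z, k)].

Lemma fgsum_gen (K : choiceType) (V : zmodType) (f : K -> V) (k : K) :
  fgsum f (fgen k) = f k.
Proof. by rewrite /fgsum /fgen liftU scale1r. Qed.

Section Presentation.
Context (K : choiceType) (rel : set {freeg K}).

Definition relators : {pred {freeg K}} :=
  fun x => `[< forall P : {pred {freeg K}},
                 zmod_closed P -> {in rel, forall y, y \in P} -> x \in P >].

Lemma relators_zmod_closed : zmod_closed relators.
Proof.
split=> [|x y /asboolP hx /asboolP hy].
  by apply/asboolP => P [].
by apply/asboolP => P hP hr; apply: hP.2; [exact: hx | exact: hy].
Qed.

HB.instance Definition _ :=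
  GRing.isZmodClosed.Build {freeg K} relators relators_zmod_closed.

Definition presented : zmodType := (Quotient.quot relators).

Definition class_of (c : {freeg K}) : presented := \pi_(Quotient.quot relators)%qT c.

(* The value of f on a class is computed on a chosen representative; it does
   not depend on that choice, and is additive, when f kills the relations. *)
Definition presented_lift (V : zmodType) (f : K -> V) (x : presented) : V :=
  fgsum f (repr (x : (Quotient.quot relators))).

End Presentation.

Definition tensor_rel (A B : zmodType) : set {freeg (A * B)%type} :=
  [set c | (exists a a' b,
              c = fgen (a + a', b) - fgen (a, b) - fgen (a', b)) \/
           (exists a b b',
              c = fgen (a, b + b') - fgen (a, b) - fgen (a, b'))].

Definition tensor (A B : zmodType) : zmodType := presented (@tensor_rel A B).

Definition pure_tensor (A B : zmodType) (a : A) (b : B) : tensor A B :=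
  class_of (@tensor_rel A B) (fgen (a, b)).

Definition tensor_mapl (A A' B : zmodType) (f : A -> A') :
  tensor A B -> tensor A' B :=
  @presented_lift _ (@tensor_rel A B) _ (fun ab => pure_tensor (f ab.1) ab.2).

(* The family f induces an isomorphism from the direct sum of the A i, i in I,
   to B: every b is the image of a unique finitely supported family. *)
Definition direct_sum_iso (I : set nat) (A : nat -> zmodType) (B : zmodType)
    (f : forall i, A i -> B) : Prop :=
  forall b : B, exists! x : forall i, A i,
    [/\ finite_set [set i | x i != 0],
        [set i | x i != 0] `<=` I &
        b = \sum_(i \in I) f i (x i)].

(* For G the torsion of H_n(M), the next two definitions give Sigma_M and D_M. *)
Definition torsion_primes (G : zmodType) : set nat :=
  [set p | prime p /\ exists x : tensor G 'F_p, x != 0].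

Definition localized (S : set nat) : {pred rat} :=
  fun x => `[< forall P : {pred rat}, subring_closed P ->
                 (forall p, S p -> p%:R^-1 \in P) -> x \in P >].

Lemma localized_zmod_closed (S : set nat) : zmod_closed (localized S).
Proof.
split=> [|x y /asboolP hx /asboolP hy]; apply/asboolP => P hP hS.
  by case: hP => P1 PB _; rewrite -(subrr 1) PB.
by case: (hP) => _ PB _; apply: PB; [exact: hx | exact: hy].
Qed.

HB.instance Definition _ (S : set nat) :=
  GRing.isZmodClosed.Build rat (localized S) (localized_zmod_closed S).

Record localization (S : set nat) :=
  Localization { locval : rat; _ : locval \in localized S }.

HB.instance Definition _ (S : set nat) := [isSub for @locval S].
HB.instance Definition _ (S : set nat) :=
  [Choice of localization S by <:].
HB.instance Definition _ (S : set nat) :=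
  [SubChoice_isSubZmodule of localization S by <:].

Section Spaces.
Context (R : realType).

Definition normsq (k : nat) (x : 'rV[R]_k) : R := \sum_(i < k) x 0 i ^+ 2.

Definition sphere_set (k : nat) : set 'rV[R]_k.+1 := [set x | normsq x = 1].
Definition sphere (k : nat) : topologicalType := set_type (@sphere_set k).

Lemma sphere_base_subproof (k : nat) :
  (delta_mx 0 0 : 'rV[R]_k.+1) \in @sphere_set k.
Proof.
rewrite inE /sphere_set /= /normsq (bigD1 ord0) //= mxE !eqxx expr1n.
rewrite big1 ?addr0// => i i0; rewrite mxE (negbTE i0) andbF expr0n //.
Qed.

Definition sphere_base (k : nat) : sphere k :=
  SigSub (@sphere_base_subproof k).

Definition cube_set (k : nat) : set 'rV[R]_k :=
  [set x | forall i, 0 <= x 0 i <= 1].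
Definition cube (k : nat) : topologicalType := set_type (@cube_set k).

Definition cube_point (k : nat) (x : cube k) : 'rV[R]_k := set_val x.

Definition cube_boundary (k : nat) : set (cube k) :=
  [set x | exists i, cube_point x 0 i = 0 \/ cube_point x 0 i = 1].

Definition homotopic (X Y : topologicalType) (f g : X -> Y) : Prop :=
  exists H : X * R -> Y,
    [/\ {within [set z | 0 <= z.2 <= 1], continuous H},
        forall x, H (x, 0) = f x & forall x, H (x, 1) = g x].

Definition k_connected (k : nat) (X : topologicalType) : Prop :=
  (exists x : X, True) /\
  forall i, (i <= k)%N -> forall f : sphere i -> X, continuous f ->
    exists c : X, homotopic f (fun=> c).

Definition closed_manifold (d : nat) (X : topologicalType) : Prop :=
  [/\ hausdorff_space X, compact [set: X] &
      forall x : X, exists (U : set X) (V : set 'rV[R]_d)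
                           (f : X -> 'rV[R]_d) (g : 'rV[R]_d -> X),
        [/\ open U, U x, open V & f @` U = V] /\
        [/\ {within U, continuous f}, {within V, continuous g} &
            {in U, cancel f g}]].

End Spaces.

Record pointed_map (X : topologicalType) (x0 : X)
    (Y : topologicalType) (y0 : Y) := PointedMap {
  pmap_fun :> continuousType X Y;
  pmap_base : pmap_fun x0 = y0
}.

Section Singular.
Context (R : realType).

Definition std_simplex_set (k : nat) : set 'rV[R]_k.+1 :=
  [set x | (forall i, 0 <= x 0 i) /\ \sum_i x 0 i = 1].
Definition std_simplex (k : nat) : topologicalType :=
  set_type (@std_simplex_set k).

Definition simplex_point (k : nat) (x : std_simplex k) : 'rV[R]_k.+1 :=
  set_val x.

Section SimplexMap.
Context (p q : nat) (f : 'I_p.+1 -> 'I_q.+1).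

Lemma simplex_map_subproof (x : std_simplex p) :
  (\row_j \sum_(i | f i == j) simplex_point x 0 i) \in @std_simplex_set q.
Proof.
have [x0 x1] : std_simplex_set (simplex_point x) by exact: set_valP.
rewrite inE; split=> [j|]; first by rewrite mxE sumr_ge0.
under eq_bigr do rewrite mxE.
by rewrite -x1 [RHS](partition_big f xpredT).
Qed.

(* The affine map of standard simplices given by f on the vertices *)
Definition simplex_map (x : std_simplex p) : std_simplex q :=
  SigSub (simplex_map_subproof x).

Lemma simplex_map_continuous : continuous simplex_map.
Proof.
apply: continuous_comp_initial => x A [/= P Pnbhs PA].
have Pcont j :
    \forall y \near x, P 0 j (\sum_(i | f i == j) simplex_point y 0 i).
  have cf : continuous (fun y : std_simplex p =>
      \sum_(i | f i == j) simplex_point y 0 i : R).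
    apply: continuous_big => [|i _]; first exact: add_continuous.
    move=> y.
    apply: (@continuous_comp _ _ _ (@simplex_point p)
              (fun z : 'rV[R]_p.+1 => z 0 i)); last exact: coord_continuous.
    exact: initial_continuous.
  by have /= := Pnbhs 0 j; rewrite mxE => /cf.
have := @filter_forall _ _ (fun j y =>
  P 0 j (\sum_(i | f i == j) simplex_point y 0 i)) (nbhs x) (nbhs_filter x) Pcont.
move=> near_P; rewrite nbhs_filterE /=.
apply: (@filterS _ _ (nbhs_filter x) _ _ _ near_P) => y Py; apply: PA => i j /=.
by rewrite ord1 mxE; exact: Py.
Qed.

HB.instance Definition _ :=
  @isContinuous.Build _ _ simplex_map simplex_map_continuous.

End SimplexMap.

Definition ssimplex (k : nat) (X : topologicalType) : choiceType :=
  continuousType (std_simplex k) X.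

Definition chain (k : nat) (X : topologicalType) : zmodType :=
  {freeg (ssimplex k X)}.

Definition reindex (X : topologicalType) (p q : nat)
    (f : 'I_p.+1 -> 'I_q.+1) (s : ssimplex q X) : ssimplex p X :=
  [the continuousType _ _ of s \o simplex_map f].

Definition boundary (k : nat) (X : topologicalType) (c : chain k.+1 X) :
    chain k X :=
  fgsum (fun s : ssimplex k.+1 X =>
    \sum_(i < k.+2) fgen (reindex (fintype.lift i) s) *~ (-1) ^+ i) c.

HB.instance Definition _ (k : nat) (X : topologicalType) :=
  GRing.isZmodMorphism.Build (chain k.+1 X) (chain k X) (@boundary k X)
    (raddfB (fgsum _)).

Definition pushforward (k : nat) (X Y : topologicalType)
    (f : continuousType X Y) (c : chain k X) : chain k Y :=
  fgsum (fun s : ssimplex k X =>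
    fgen ([the continuousType _ _ of f \o s] : ssimplex k Y)) c.

HB.instance Definition _ (k : nat) (X Y : topologicalType)
    (f : continuousType X Y) :=
  GRing.isZmodMorphism.Build (chain k X) (chain k Y) (@pushforward k X Y f)
    (raddfB (fgsum _)).

Lemma freeg_additive_eq (K : choiceType) (V : zmodType)
    (f g : {additive {freeg K} -> V}) :
  (forall k, f (fgen k) = g (fgen k)) -> f =1 g.
Proof.
move=> fg c; rewrite -[c]freeg_sumE !raddf_sum; apply: eq_bigr => k _.
have -> : Freeg [:: (coeff k c, k)] = fgen k *~ coeff k c.
  apply/eqP/freeg_eqP => k'.
  by rewrite raddfMz /= !coeffU mul1r -mulrzl intz.
by rewrite !raddfMz fg.
Qed.

Lemma boundary_pushforward (k : nat) (X Y : topologicalType)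
    (f : continuousType X Y) (c : chain k.+1 X) :
  boundary (pushforward f c) = pushforward f (boundary c).
Proof.
pose F := [the {additive chain k.+1 X -> chain k Y} of
  @boundary k Y \o pushforward f].
pose G := [the {additive chain k.+1 X -> chain k Y} of
  pushforward f \o @boundary k X].
apply: (@freeg_additive_eq (ssimplex k.+1 X) _ F G) => s /=.
rewrite /boundary /pushforward !fgsum_gen raddf_sum /=.
apply: eq_bigr => i _; rewrite raddfMz /= fgsum_gen.
congr (fgen _ *~ _).
exact/continuousEP.
Qed.

Definition cycles (k : nat) (X : topologicalType) : {pred chain k X} :=
  match k with
  | 0 => fun=> true
  | k'.+1 => fun c : chain k'.+1 X => boundary c == 0
  end.
Arguments cycles : clear implicits.

Lemma cycles_zmod_closed (k : nat) (X : topologicalType) :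
  zmod_closed (cycles k X).
Proof.
case: k => [|k]; first by split.
split=> [|x y /eqP hx /eqP hy]; first by rewrite unfold_in raddf0.
by rewrite unfold_in raddfB /= hx hy subrr.
Qed.

HB.instance Definition _ (k : nat) (X : topologicalType) :=
  GRing.isZmodClosed.Build (chain k X) (cycles k X) (cycles_zmod_closed k X).

Record cycle (k : nat) (X : topologicalType) :=
  Cycle { cycle_chain : chain k X; _ : cycle_chain \in cycles k X }.

HB.instance Definition _ (k : nat) (X : topologicalType) :=
  [isSub for @cycle_chain k X].
HB.instance Definition _ (k : nat) (X : topologicalType) :=
  [Choice of cycle k X by <:].
HB.instance Definition _ (k : nat) (X : topologicalType) :=
  [SubChoice_isSubZmodule of cycle k X by <:].

Definition boundaries (k : nat) (X : topologicalType) : {pred cycle k X} :=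
  fun z => `[< exists c : chain k.+1 X, cycle_chain z = boundary c >].
Arguments boundaries : clear implicits.

Lemma boundaries_zmod_closed (k : nat) (X : topologicalType) :
  zmod_closed (boundaries k X).
Proof.
split=> [|x y /asboolP[a ha] /asboolP[b hb]]; apply/asboolP.
  by exists 0; rewrite raddf0.
by exists (a - b); rewrite raddfB /= -ha -hb -[LHS]/(val (x - y)) raddfB.
Qed.

HB.instance Definition _ (k : nat) (X : topologicalType) :=
  GRing.isZmodClosed.Build (cycle k X) (boundaries k X)
    (boundaries_zmod_closed k X).

Definition homology (k : nat) (X : topologicalType) : zmodType :=
  Quotient.quot (boundaries k X).

Definition homology_rep (k : nat) (X : topologicalType) (x : homology k X) :
    cycle k X := repr (x : Quotient.quot (boundaries k X)).

Lemma pushforward_cycle (k : nat) (X Y : topologicalType)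
    (f : continuousType X Y) (z : cycle k X) :
  pushforward f (cycle_chain z) \in cycles k Y.
Proof.
case: k z => [//|k] [z /= /eqP hz].
by rewrite unfold_in boundary_pushforward hz raddf0.
Qed.

Definition homology_map (k : nat) (X Y : topologicalType)
    (f : continuousType X Y) (x : homology k X) : homology k Y :=
  \pi_(Quotient.quot (boundaries k Y))%qT
    (Cycle (pushforward_cycle f (homology_rep x))).

Definition cochain (k : nat) (X : topologicalType) := ssimplex k X -> int.

Definition is_cocycle (k : nat) (X : topologicalType) (w : cochain k X) :=
  forall c : chain k.+1 X, fgsum w (boundary c) = 0.

(* The Kronecker pairing of the class of a cocycle with a homology class *)
Definition kronecker (k : nat) (X : topologicalType) (w : cochain k X)
    (x : homology k X) : int :=
  fgsum w (cycle_chain (homology_rep x)).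

Definition cup (p q : nat) (X : topologicalType)
    (w : cochain p X) (w' : cochain q X) : cochain (p + q) X :=
  fun s => w (reindex (fun i : 'I_p.+1 => inord i) s)
         * w' (reindex (fun i : 'I_q.+1 => inord (p + i)) s).

End Singular.

Definition additive_iso (A B : zmodType) : Prop :=
  exists f : {additive A -> B}, bijective f.

(* A is infinite cyclic with generator x. For a closed connected d-manifold, the
   generators of H_d are its fundamental classes, i.e. its orientations. *)
Definition generates (A : zmodType) (x : A) : Prop :=
  forall y : A, exists! k : int, y = x *~ k.

Definition basis_mod_torsion (A : zmodType) (r : nat) (v : 'I_r -> A) : Prop :=
  forall x : A, exists! c : 'I_r -> int,
    exists2 N : nat, (0 < N)%N & (x - \sum_i v i *~ c i) *+ N = 0.

Section HomotopyGroups.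
Context (R : realType).

Record loop (s : nat) (X : topologicalType) (x0 : X) := Loop {
  loop_fun :> continuousType (cube R s) X;
  loop_boundary : forall x, @cube_boundary R s x -> loop_fun x = x0
}.

HB.instance Definition _ (s : nat) (X : topologicalType) (x0 : X) :=
  gen_eqMixin (loop s x0).
HB.instance Definition _ (s : nat) (X : topologicalType) (x0 : X) :=
  gen_choiceMixin (loop s x0).

Definition loop_homotopic (s : nat) (X : topologicalType) (x0 : X)
    (a b : loop s x0) : Prop :=
  exists H : cube R s * R -> X,
    [/\ {within [set z | 0 <= z.2 <= 1], continuous H},
        forall x, H (x, 0) = a x, forall x, H (x, 1) = b x &
        forall x t, cube_boundary x -> 0 <= t <= 1 -> H (x, t) = x0].

(* c is the concatenation of a and b along the first coordinate of the cube *)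
Definition loop_concat (s : nat) (X : topologicalType) (x0 : X)
    (a b c : loop s x0) : Prop :=
  forall x y : cube R s,
    ((forall i : 'I_s, cube_point y 0 i =
        if i == 0%N :> nat then 2 * cube_point x 0 i else cube_point x 0 i) ->
       c x = a y) /\
    ((forall i : 'I_s, cube_point y 0 i =
        if i == 0%N :> nat then 2 * cube_point x 0 i - 1
        else cube_point x 0 i) ->
       c x = b y).

Definition pi_rel (s : nat) (X : topologicalType) (x0 : X) :
    set {freeg (loop s x0)} :=
  [set z | (exists a b, loop_homotopic a b /\ z = fgen a - fgen b) \/
           (exists a b c, loop_concat a b c /\ z = fgen c - fgen a - fgen b)].

(* The abelian group presented by the multiplication table of the homotopy
   classes of maps (I^s, bd I^s) -> (X, x0): this is the s-th homotopy group
   for s >= 2, and the abelianized fundamental group for s = 1. *)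
Definition pi (s : nat) (X : topologicalType) (x0 : X) : zmodType :=
  presented (@pi_rel s X x0).

Section PiMap.
Context (s : nat) (X Y : topologicalType) (x0 : X) (y0 : Y).
Context (f : pointed_map x0 y0).

Lemma loop_map_subproof (a : loop s x0) (x : cube R s) :
  @cube_boundary R s x ->
  [the continuousType _ _ of pmap_fun f \o loop_fun a] x = y0.
Proof. by move=> bx /=; rewrite (loop_boundary a bx) pmap_base. Qed.

Definition loop_map (a : loop s x0) : loop s y0 :=
  Loop (@loop_map_subproof a).

Definition pi_map : pi s x0 -> pi s y0 :=
  @presented_lift _ (@pi_rel s X x0) _
    (fun a => class_of (@pi_rel s Y y0) (fgen (loop_map a))).

End PiMap.

(* The relative homeomorphism (D^p, bd D^p) -> (S^p, base point) *)
Definition collapse_point (p : nat) (x : 'rV[R]_p) : 'rV[R]_p.+1 :=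
  row_mx (const_mx (2 * normsq x - 1) : 'rV_1)
         ((2 * Num.sqrt (1 - normsq x)) *: x).

Lemma collapse_on_sphere (p : nat) (x : 'rV[R]_p) :
  normsq x <= 1 -> @sphere_set R p (collapse_point x).
Proof.
move=> x1; rewrite /sphere_set /= {1}/normsq /collapse_point.
rewrite (@big_split_ord _ _ _ 1 p) /= big_ord1.
rewrite (@row_mxEl _ _ 1 p) mxE.
under eq_bigr do rewrite (@row_mxEr _ _ 1 p) mxE exprMn exprMn sqr_sqrtr ?subr_ge0//.
rewrite -mulr_sumr -/(normsq x); move: (normsq x) => t.
by rewrite sqrrB expr1n mulr1; ring.
Qed.

(* The default value is only used outside of the unit disc. *)
Definition collapse (p : nat) (x : 'rV[R]_p) : sphere R p :=
  insubd (sphere_base R p) (collapse_point x).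

Definition slice (N a p : nat) (z : 'rV[R]_N) : 'rV[R]_p :=
  \row_(i < p) oapp (z 0) 0 (insub (a + i)).

(* S^(p+q-1) is identified with the boundary of D^p x D^q by rescaling
   (x, y) so that the larger of |x|, |y| becomes 1. The Whitehead product is
   (x, y) |-> g(y) when |x| = 1 and f(x) when |y| = 1, where f and g are seen
   as maps on discs that are constant on the boundary. It is well defined when
   f and g send the base points of the spheres to the same point. *)
Definition whitehead (p q : nat) (X : Type) (f : sphere R p -> X)
    (g : sphere R q -> X) (z : sphere R (p + q).-1) : X :=
  let x := slice 0 p (set_val z) in
  let y := slice p q (set_val z) in
  if normsq y <= normsq x then g (collapse ((Num.sqrt (normsq x))^-1 *: y))
  else f (collapse ((Num.sqrt (normsq y))^-1 *: x)).

End HomotopyGroups.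

(* inl j is u_j and inr j is u'_j *)
Definition letter (r : nat) : finType := ('I_r + 'I_r)%type.

Definition letter_degree (n r : nat) (a : letter r) : nat :=
  match a with inl _ => n.-1 | inr _ => n end.

Section Lyndon.
Context (r : nat) (lt : rel (letter r)).

Fixpoint lexlt (v w : seq (letter r)) : bool :=
  match v, w with
  | _, [::] => false
  | [::], _ :: _ => true
  | a :: v', b :: w' => lt a b || (a == b) && lexlt v' w'
  end.

Definition lyndon (w : seq (letter r)) : bool :=
  (w != [::]) && all (fun k => lexlt w (rot k w)) (iota 1 (size w).-1).

Inductive bracket : Type :=
| Letter of letter r
| Bracket of bracket & bracket.

(* standard_bracketing l b : b is the formal bracket b(l). In the second rule,
   w is the longest proper right factor of v ++ w that is a Lyndon word. *)
Inductive standard_bracketing : seq (letter r) -> bracket -> Prop :=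
| standard_letter a : standard_bracketing [:: a] (Letter a)
| standard_bracket (v w : seq (letter r)) (bv bw : bracket) :
    lyndon v -> lyndon w ->
    (forall k, (0 < k < size v)%N -> ~~ lyndon (drop k (v ++ w))) ->
    standard_bracketing v bv -> standard_bracketing w bw ->
    standard_bracketing (v ++ w) (Bracket bv bw).

End Lyndon.

(* The degree of an iterated bracket of letters in the graded Lie algebra L(M) *)
Fixpoint bracket_degree (n r : nat) (b : bracket r) : nat :=
  match b with
  | Letter a => letter_degree n a
  | Bracket b1 b2 => bracket_degree n b1 + bracket_degree n b2
  end.

Section LetterOrder.
Context (r : nat) (r_gt0 : (0 < r)%N).

Definition u1 : letter r := inl (Ordinal r_gt0).
Definition u1' : letter r := inr (Ordinal r_gt0).

Definition letter_order (lt : rel (letter r)) : Prop :=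
  [/\ irreflexive lt, transitive lt,
      forall a b, a != b -> lt a b || lt b a,
      lt u1 u1' &
      forall a, a \notin [:: u1; u1'] -> lt u1 a && lt u1' a].

Definition admissible (lt : rel (letter r)) : set (seq (letter r)) :=
  [set w | lyndon lt w /\ ~~ infix [:: u1; u1'] w].

End LetterOrder.

Section Decomposition.
Context (R : realType) (n r : nat) (M : topologicalType) (x0 : M).

Definition sphere_map (k : nat) := pointed_map (sphere_base R k) x0.

Section IteratedWhitehead.
Context (nu : 'I_r -> sphere_map n) (nu' : 'I_r -> sphere_map n.+1).

(* M is simply connected, so that a based map is determined up to based
   homotopy by its free homotopy class. *)
Inductive iterated_whitehead :
    bracket r -> forall k : nat, sphere_map k -> Prop :=
| whitehead_u j : iterated_whitehead (Letter (inl j)) (nu j)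
| whitehead_u' j : iterated_whitehead (Letter (inr j)) (nu' j)
| whitehead_bracket (b1 b2 : bracket r) (p q : nat)
    (f : sphere_map p) (g : sphere_map q) (h : sphere_map (p + q).-1) :
    iterated_whitehead b1 f -> iterated_whitehead b2 g ->
    homotopic R h (whitehead f g) ->
    iterated_whitehead (Bracket b1 b2) h.

(* iota and iota' are the fundamental classes used to define the Hurewicz
   images of the maps nu and nu'. *)
Definition dual_hurewicz_bases (mu : homology R (n + n.+1) M) : Prop :=
  exists (iota : homology R n (sphere R n))
         (iota' : homology R n.+1 (sphere R n.+1))
         (w : 'I_r -> cochain R n M) (w' : 'I_r -> cochain R n.+1 M),
    let v j := homology_map (nu j) iota in
    let v' j := homology_map (nu' j) iota' in
    [/\ generates iota /\ generates iota',
        basis_mod_torsion v /\ basis_mod_torsion v',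
        (forall i, is_cocycle (w i)) /\ (forall i, is_cocycle (w' i)),
        (forall i j, kronecker (w i) (v j) = (i == j)%:R) /\
        (forall i j, kronecker (w' i) (v' j) = (i == j)%:R) &
        forall i j, kronecker (cup (w i) (w' j)) mu = (i == j)%:R].

End IteratedWhitehead.

(* Terms indexed outside of dec_index are irrelevant. *)
Record decomposition (r_gt0 : (0 < r)%N) (G : zmodType)
    (mu : homology R (n + n.+1) M) := Decomposition {
  dec_nu : 'I_r -> sphere_map n;
  dec_nu' : 'I_r -> sphere_map n.+1;
  dec_dual : dual_hurewicz_bases dec_nu dec_nu' mu;
  dec_lt : rel (letter r);
  dec_order : letter_order r_gt0 dec_lt;
  dec_index : set nat;
  dec_initial : forall i j, (i <= j)%N -> dec_index j -> dec_index i;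
  dec_word : nat -> seq (letter r);
  dec_listing : set_bij dec_index (admissible r_gt0 dec_lt) dec_word;
  dec_bracket : nat -> bracket r;
  dec_standard : forall i, dec_index i ->
    standard_bracketing dec_lt (dec_word i) (dec_bracket i);
  dec_height := fun i => (bracket_degree n (dec_bracket i)).+1;
  dec_nondecreasing : forall i j, (i <= j)%N -> dec_index j ->
    (dec_height i <= dec_height j)%N;
  dec_lambda : forall i, sphere_map (dec_height i);
  dec_lambda_whitehead : forall i, dec_index i ->
    iterated_whitehead dec_nu dec_nu' (dec_bracket i) (dec_lambda i);
  dec_iso : forall s, (0 < s)%N ->
    @direct_sum_iso dec_index
      (fun i => tensor (pi R s (sphere_base R (dec_height i)))
                       (localization (torsion_primes G)))
      (tensor (pi R s x0) (localization (torsion_primes G)))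
      (fun i => @tensor_mapl _ _ (localization (torsion_primes G))
                  (@pi_map R s _ _ _ _ (dec_lambda i)))
}.

End Decomposition.

Definition mobius (j : nat) : int :=
  if all (fun p => logn p j == 1%N) (primes j) then (-1) ^+ size (primes j)
  else 0.

Definition qpoly (n r : nat) : {poly rat} :=
  1 - r%:R *: 'X^(n.-1) - r%:R *: 'X^n + 'X^((2 * n).-1).

(* For q with constant term 1, the coefficient of t^m in
   log q = sum_(k >= 1) (-1)^(k+1) (q - 1)^k / k; the terms with k > m do not
   contribute to it. *)
Definition log_coef (q : {poly rat}) (m : nat) : rat :=
  \sum_(1 <= k < m.+1) (-1) ^+ k.+1 * ((q - 1) ^+ k)`_m / k%:R.

Definition eta (n r m : nat) : rat := log_coef (qpoly n r) m.

(* Main.v *)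
Require Import Defs.
From mathcomp Require Import all_boot all_order all_algebra finmap.
From mathcomp Require Import all_classical reals topology normedtype.
From mathcomp Require Import ring zify.

Set Implicit Arguments.
Unset Strict Implicit.
Unset Printing Implicit Defensive.

Import Order.TTheory GRing.Theory Num.Theory numFieldNormedType.Exports.

Local Open Scope classical_set_scope.
Local Open Scope ring_scope.

(* A nontrivial Lyndon word begins with its smallest letter, so it avoids
   [u1 u1'] if and only if it avoids it cyclically. Every nonempty word is
   [rot i (l^j)] for a unique Lyndon word [l], a unique [j > 0] and a unique
   [i < |l|]. Hence the sum [F_w] of the degrees of the first letters of the
   cyclically avoiding words of weight [w] is the sum of [k l_k] over the
   divisors [k] of [w], where [l_k] counts the admissible Lyndon words of
   weight [k]. Peeling off letters one at a time shows that the generating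
   function of the linearly avoiding words is [1/q] and that of [F] is
   [- t q'/q], so that [F_w = - w eta_w]. Moebius inversion then gives [l_w];
   finally, the indices [i] with [h_i = m] correspond to the admissible Lyndon
   words of weight [m - 1]. *)

(** * Lyndon words and rotations *)

Definition power (T : Type) (j : nat) (s : seq T) : seq T :=
  flatten (nseq j s).

Lemma size_power (T : Type) (j : nat) (s : seq T) :
  size (power j s) = (j * size s)%N.
Proof. by rewrite size_flatten /shape map_nseq sumn_nseq mulnC. Qed.

Lemma power_cat_comm (T : Type) (j : nat) (s t : seq T) :
  power j (s ++ t) ++ s = s ++ power j (t ++ s).
Proof.
elim: j => [|j IHj]; first by rewrite /= cats0.
by rewrite /power /= -/(power j _) -catA IHj -/(power j _) !catA.
Qed.

(** Write [s] as [t ++ u] with [size t = i]. Rotation moves the leading [t] behind all the copies,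
    and [power_cat_comm] carries it back through them. *)
Lemma rot_power (T : Type) (i j : nat) (s : seq T) :
  (i <= size s)%N -> rot i (power j s) = power j (rot i s).
Proof.
case: j => [|j] i_le; first by case: i i_le.
have szt : size (take i s) = i by rewrite size_takel.
rewrite -{1}[s](cat_take_drop i) -{1}szt /power /= -/(power j _) -catA.
by rewrite rot_size_cat -catA power_cat_comm catA.
Qed.

Lemma rot_mul_fixed (T : Type) (p q : nat) (s : seq T) :
  rot p s = s -> (q * p <= size s)%N -> rot (q * p) s = s.
Proof.
move=> fix_s; elim: q => [|q IHq]; first by rewrite mul0n rot0.
by rewrite mulSn => qp_le; rewrite rotD// IHq//; lia.
Qed.

(** Lets rotation indices be reduced modulo a period. The bound on [i] matters because [rot] does
    not wrap around past the length. *)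
Lemma rot_mod_fixed (T : Type) (p i : nat) (s : seq T) :
  rot p s = s -> (i <= size s)%N -> rot (i %% p) s = rot i s.
Proof.
move=> fix_s i_le; rewrite [in RHS](divn_eq i p) addnC rotD.
  by rewrite rot_mul_fixed//; lia.
by rewrite addnC -divn_eq.
Qed.

(** For [q > 0] the commutation shows that [s] is a prefix of [t]; removing it leaves a shorter word
    that still commutes with [s]. *)
Lemma commuting_power (T : eqType) (q : nat) (s t : seq T) :
  s ++ t = t ++ s -> size t = (q * size s)%N -> t = power q s.
Proof.
elim: q t => [|q IHq] t comm szt; first by apply: size0nil; lia.
have t_s : take (size s) t = s.
  have := congr1 (take (size s)) comm; rewrite take_size_cat// takel_cat//.
  by rewrite szt; lia.
rewrite -[t](cat_take_drop (size s)) t_s /power /=; congr (_ ++ _).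
apply: IHq; last by rewrite size_drop szt; lia.
move: comm; rewrite -{1 2}[t](cat_take_drop (size s)) t_s -catA => /eqP.
by rewrite eqseq_cat// eqxx /= => /eqP.
Qed.

(** Take for [p] the least positive index whose rotation fixes [s]. Rotation by [size s] also fixes
    [s], so by minimality [size s] leaves no remainder modulo [p]. The first [p] letters commute
    with the rest, and [commuting_power] applies. *)
Lemma primitive_root (T : eqType) (s : seq T) : s != [::] ->
  exists p j, [/\ (0 < p <= size s)%N, (0 < j)%N, s = power j (take p s),
    rot p s = s &
    forall i, (0 < i < p)%N -> rot i s != s].
Proof.
move=> s_neq0; have szs : (0 < size s)%N by rewrite lt0n size_eq0.
have ex : exists p, (0 < p)%N && (rot p s == s).
  by exists (size s); rewrite szs rot_size eqxx.
case: (ex_minnP ex) => p /andP[p_gt0 /eqP fix_s] p_min.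
have p_le : (p <= size s)%N by apply: p_min; rewrite szs rot_size eqxx.
have p_dvd : (p %| size s)%N.
  rewrite /dvdn; apply: contraT; rewrite -lt0n => r_gt0.
  have := p_min (size s %% p)%N; rewrite r_gt0 rot_mod_fixed// rot_size eqxx.
  by move/(_ isT); rewrite leqNgt ltn_pmod.
have [j szs_j] := dvdnP p_dvd.
case: j szs_j => [|j] szs_j; first by move: szs; rewrite szs_j.
exists p, j.+1; split=> // [||i /andP[i_gt0 i_lt]].
- by rewrite p_gt0.
- rewrite -[LHS](cat_take_drop p) /power /= -/(power j _); congr (_ ++ _).
  apply: commuting_power.
    by rewrite cat_take_drop -[LHS]fix_s.
  by rewrite size_takel// size_drop szs_j mulSn addKn.
- apply: contraTN i_lt => fix_i; rewrite -leqNgt; apply: p_min.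
by rewrite i_gt0.
Qed.

Section LyndonPowers.
Context (r : nat) (lt : rel (letter r)).
Context (lt_irr : irreflexive lt) (lt_trans : transitive lt).
Context (lt_total : forall a b, a != b -> lt a b || lt b a).

Local Notation word := (seq (letter r)).

Lemma lexlt_irr (v : word) : lexlt lt v v = false.
Proof. by elim: v => //= a v ->; rewrite lt_irr eqxx. Qed.

Lemma lexlt_trans : transitive (lexlt lt).
Proof.
move=> w v; elim: w v => [|b w IHw] [|a v] [|c x] //=.
case/orP=> [ab|/andP[/eqP<- vw]] /orP[bc|/andP[/eqP bc wx]].
- by rewrite (lt_trans ab bc).
- by rewrite -bc ab.
- by rewrite bc.
- by rewrite bc eqxx (IHw _ _ vw wx) orbT.
Qed.

Lemma lexlt_total (v w : word) : v != w -> lexlt lt v w || lexlt lt w v.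
Proof.
elim: v w => [|a v IHv] [|b w] //=; rewrite eqseq_cons.
have [-> /= /IHv|ab _] := eqVneq a b; first by rewrite lt_irr.
by case/orP: (lt_total ab) => ->; rewrite ?orbT.
Qed.

Lemma lexlt_cat (s s' t t' : word) : size s = size s' ->
  lexlt lt s s' -> lexlt lt (s ++ t) (s' ++ t').
Proof.
elim: s s' => [|a s IHs] [|b s'] //= [sz] /orP[->//|/andP[-> ss']].
by rewrite IHs ?orbT.
Qed.

Lemma lexlt_power (j : nat) (s t : word) : (0 < j)%N -> size s = size t ->
  lexlt lt s t -> lexlt lt (power j s) (power j t).
Proof. by case: j => // j _; exact: lexlt_cat. Qed.

Lemma lexlt_min (s : seq word) : s != [::] ->
  exists2 v, v \in s & forall w, w \in s -> ~~ lexlt lt w v.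
Proof.
elim: s => // v [|w s] IHs _.
  by exists v; rewrite ?mem_head// => w; rewrite inE => /eqP->; rewrite lexlt_irr.
have [//|x x_in x_min] := IHs; have [vx|vx] := boolP (lexlt lt v x).
  exists v; rewrite ?mem_head// => y; rewrite inE => /orP[/eqP->|/x_min].
    by rewrite lexlt_irr.
  by apply: contra => /lexlt_trans; exact.
exists x; first by rewrite in_cons x_in orbT.
by move=> y; rewrite inE => /orP[/eqP->|/x_min].
Qed.

Lemma lyndonP (v : word) :
  reflect (v != [::] /\ forall k, (0 < k < size v)%N -> lexlt lt v (rot k v))
          (lyndon lt v).
Proof.
apply: (iffP andP) => -[v_neq0 vP]; split=> //.
  move=> k k_lt; apply: (allP vP); rewrite mem_iota; lia.
apply/allP => k; rewrite mem_iota => k_lt; apply: vP; lia.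
Qed.

Lemma lyndon_power_lt (i j : nat) (l : word) : lyndon lt l -> (0 < j)%N ->
  (0 < i < size l)%N -> lexlt lt (power j l) (rot i (power j l)).
Proof.
move=> /lyndonP[_ lP] j_gt0 i_lt; rewrite rot_power; last by lia.
by apply: lexlt_power; rewrite ?size_rot// lP.
Qed.

Lemma lyndon_power_min (i j : nat) (l : word) : lyndon lt l -> (0 < j)%N ->
  ~~ lexlt lt (rot i (power j l)) (power j l).
Proof.
(* An index beyond the length acts like the length, so it is capped before being reduced modulo
   [size l]. *)
move=> l_lyndon j_gt0; rewrite rot_minn.
rewrite -(@rot_mod_fixed _ (size l)) ?geq_minr//; last first.
  by rewrite rot_power// rot_size.
set k := (_ %% _)%N; have [->|k_gt0] := posnP k; first by rewrite rot0 lexlt_irr.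
have szl : (0 < size l)%N by rewrite lt0n size_eq0; case/lyndonP: l_lyndon.
have := @lyndon_power_lt k j l l_lyndon j_gt0.
rewrite k_gt0 ltn_pmod// => /(_ isT).
by move=> lk; apply/negP => /(lexlt_trans lk); rewrite lexlt_irr.
Qed.

(** Roots of equal length are both the first block of the common word. If [l] were shorter, rotation
    by [size l] would fix that word, whereas [lyndon_power_lt] for [l'] makes it strictly larger. *)
Lemma lyndon_power_eq (j j' : nat) (l l' : word) :
  lyndon lt l -> lyndon lt l' -> (0 < j)%N -> (0 < j')%N ->
  power j l = power j' l' -> l = l'.
Proof.
wlog sz : j j' l l' / (size l <= size l')%N.
  move=> wl lL lL' j0 j0' eq_p; have [|sz] := leqP (size l) (size l').
    by move=> sz; exact: wl eq_p.
  by apply/esym; apply: (wl j' j) => //; exact: ltnW.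
move=> l_lyndon l_lyndon' j_gt0 j_gt0' eq_p.
have l_neq0 : l != [::] by case/lyndonP: l_lyndon.
have eq_sz : size l = size l'.
  apply/eqP; rewrite eqn_leq sz leqNgt /=; apply/negP => szlt.
  have := @lyndon_power_lt (size l) j' l' l_lyndon' j_gt0'.
  rewrite szlt lt0n size_eq0 l_neq0 => /(_ isT).
  by rewrite -eq_p rot_power// rot_size lexlt_irr.
case: j j' j_gt0 j_gt0' eq_p => [//|j] [//|j'] _ _ /eqP.
by rewrite /power /= eqseq_cat// => /andP[/eqP].
Qed.

(** Each power is minimal among its rotations, so two powers that are rotations of each other
    coincide, and so do their roots. If two distinct offsets below [size l] gave the same word,
    rotation by their difference would fix the power, against [lyndon_power_lt]. *)
Lemma rot_lyndon_power_inj (i i' j j' : nat) (l l' : word) :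
  lyndon lt l -> lyndon lt l' -> (0 < j)%N -> (0 < j')%N ->
  (i < size l)%N -> (i' < size l')%N ->
  rot i (power j l) = rot i' (power j' l') -> l = l' /\ i = i'.
Proof.
move=> l_lyndon l_lyndon' j_gt0 j_gt0' i_lt i_lt' eq_rot.
have [k Ek] : exists k, power j l = rot k (power j' l').
  have := congr1 (rotr i) eq_rot; rewrite rotK /rotr rot_rot_add => ->.
  by eexists.
have [k' Ek'] : exists k, power j' l' = rot k (power j l).
  have := congr1 (rotr i') eq_rot; rewrite rotK /rotr rot_rot_add => <-.
  by eexists.
have eq_p : power j l = power j' l'.
  apply/eqP; apply: contraT => /lexlt_total /orP[].
    by rewrite Ek => h; have := lyndon_power_min k l_lyndon' j_gt0'; rewrite h.
  by rewrite Ek' => h; have := lyndon_power_min k' l_lyndon j_gt0; rewrite h.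
have eq_l := lyndon_power_eq l_lyndon l_lyndon' j_gt0 j_gt0' eq_p.
split=> //; rewrite -eq_p in eq_rot; rewrite -eq_l in i_lt'.
have aux a b : (a < b)%N -> (b < size l)%N ->
    rot a (power j l) <> rot b (power j l).
  move=> ab b_lt eq_ab; have := @lyndon_power_lt (b - a) j l l_lyndon j_gt0.
  rewrite subn_gt0 ab (leq_ltn_trans (leq_subr _ _) b_lt) => /(_ isT).
  suff -> : rot (b - a) (power j l) = power j l by rewrite lexlt_irr.
  apply: (@rot_inj a); rewrite -rotD subnKC ?(ltnW ab)//.
  by rewrite size_power (leq_trans (ltnW b_lt))// leq_pmull.
case: (ltngtP i i') => // [/aux/(_ i_lt')|/aux/(_ i_lt)] []; exact/esym.
Qed.

(** The root is the primitive root of the smallest rotation [m] of [v]: a smaller rotation of the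
    root would give a rotation of [m] below [m], and an equal one is excluded by primitivity. *)
Lemma exists_lyndon_root (v : word) : v != [::] ->
  exists l j i, [/\ lyndon lt l, (0 < j)%N, (i < size l)%N &
                    v = rot i (power j l)].
Proof.
move=> v_neq0; have szv : (0 < size v)%N by rewrite lt0n size_eq0.
(* The range includes [size v] because the index [rot_add v i0 i] of a composite rotation is only
   known to be at most [size v]. *)
have [|m /mapP[i0 _ m_rot] m_min] :=
  @lexlt_min [seq rot i v | i <- iota 0 (size v).+1]; first by [].
have m_min' i : ~~ lexlt lt (rot i m) m.
  apply: m_min; rewrite m_rot rot_rot_add; apply/mapP.
  exists (rot_add v i0 i) => //; rewrite mem_iota /= add0n ltnS.
  exact: leq_rot_add.
have m_neq0 : m != [::] by rewrite -size_eq0 m_rot size_rot size_eq0.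
have [p [j [/andP[p_gt0 p_le] j_gt0 m_pow p_fix p_min]]] := primitive_root m_neq0.
have szl : size (take p m) = p by rewrite size_takel.
have [i i_le v_rot] : exists2 i, (i <= size m)%N & v = rot i m.
  exists (size m - i0)%N; first exact: leq_subr.
  by rewrite -[v](@rotK i0) -m_rot /rotr.
exists (take p m), j, (i %% p)%N; split=> //; last 2 first.
- by rewrite szl ltn_pmod.
- by rewrite -m_pow rot_mod_fixed.
apply/lyndonP; split; first by rewrite -size_eq0 szl -lt0n.
rewrite szl => k k_lt.
have rk : rot k m = power j (rot k (take p m)).
  by rewrite {1}m_pow rot_power// szl; lia.
have neq : take p m != rot k (take p m).
  by apply: contraNneq (p_min _ k_lt) => eq_l; rewrite rk -eq_l -m_pow.
case/orP: (lexlt_total neq) => // lt_rot.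
by have := m_min' k; rewrite rk {2}m_pow lexlt_power// size_rot.
Qed.

End LyndonPowers.

(** * Words avoiding a factor of length two *)

Definition weight (T : Type) (d : T -> nat) (v : seq T) : nat :=
  sumn (map d v).

Lemma weight_cat (T : Type) (d : T -> nat) (s t : seq T) :
  weight d (s ++ t) = (weight d s + weight d t)%N.
Proof. by rewrite /weight map_cat sumn_cat. Qed.

Lemma weight_rot (T : Type) (d : T -> nat) (i : nat) (s : seq T) :
  weight d (rot i s) = weight d s.
Proof. by rewrite -[in RHS](cat_take_drop i s) !weight_cat addnC. Qed.

Lemma weight_rev (T : Type) (d : T -> nat) (s : seq T) :
  weight d (rev s) = weight d s.
Proof. by rewrite /weight map_rev sumn_rev. Qed.

Lemma weight_power (T : Type) (d : T -> nat) (j : nat) (s : seq T) :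
  weight d (power j s) = (j * weight d s)%N.
Proof.
by elim: j => //= j IHj; rewrite /power /= -/(power j s) weight_cat IHj mulSn.
Qed.

Definition avoids (T : eqType) (a b : T) : rel T :=
  fun x y => ~~ ((x == a) && (y == b)).

Lemma sorted_avoids (T : eqType) (a b : T) (v : seq T) :
  sorted (avoids a b) v = ~~ infix [:: a; b] v.
Proof.
elim: v => // x [|y v] IHv; first by rewrite /= andbF.
rewrite [LHS]/= -/(sorted _ (y :: v)) IHv [infix _ (x :: _)]/= negb_or.
by rewrite prefix0s andbT /avoids (eq_sym a) (eq_sym b).
Qed.

(** Multiplication by $t^k$ on coefficient sequences; the test keeps truncated subtraction from
    reading [f 0]. *)
Definition shift (V : nmodType) (k : nat) (f : nat -> V) (w : nat) : V :=
  if (w < k)%N then 0 else f (w - k)%N.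

Lemma shiftD (V : nmodType) (k l : nat) (f : nat -> V) (w : nat) :
  shift k (shift l f) w = shift (k + l) f w.
Proof.
rewrite /shift subnDA; case: ltnP => wk; first by rewrite ltn_addr.
by have -> : (w - k < l)%N = (w < k + l)%N by lia.
Qed.

Section Words.
Context (T : finType) (d : T -> nat) (d_gt0 : forall x, (0 < d x)%N).

(** Letters have positive weight, so a word of weight [w] has at most [w] letters and tuples up to
    that length suffice. *)
Definition words (w : nat) : seq (seq T) :=
  undup [seq v <- flatten [seq [seq val t | t <- enum {: k.-tuple T}]
                          | k <- iota 0 w.+1] | weight d v == w].

Lemma size_le_weight (v : seq T) : (size v <= weight d v)%N.
Proof. by elim: v => //= x v IHv; rewrite -add1n leq_add. Qed.

Lemma mem_words (w : nat) (v : seq T) : (v \in words w) = (weight d v == w).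
Proof.
rewrite mem_undup mem_filter andb_idr// => /eqP wv.
apply/flattenP; exists [seq val t | t <- enum {: (size v).-tuple T}].
  by apply/mapP; exists (size v); rewrite // mem_iota ltnS -wv size_le_weight.
by apply/mapP; exists (in_tuple v); rewrite // mem_enum.
Qed.

Lemma words_uniq (w : nat) : uniq (words w).
Proof. exact: undup_uniq. Qed.

Lemma weight_eq0 (v : seq T) : (weight d v == 0%N) = (v == [::]).
Proof.
by case: v => //= x v; rewrite addn_eq0 -[d x == 0%N]negbK -lt0n d_gt0.
Qed.

Lemma sum_words_rev (V : nmodType) (F : seq T -> V) (w : nat) :
  \sum_(v <- words w) F v = \sum_(v <- words w) F (rev v).
Proof.
rewrite -(big_map rev xpredT F); apply: perm_big; apply: uniq_perm.
- exact: words_uniq.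
- by rewrite (map_inj_uniq (can_inj revK)) words_uniq.
move=> v; rewrite -[in RHS](revK v) (mem_map (can_inj revK)) !mem_words.
by rewrite weight_rev.
Qed.

Lemma sum_words_cons (V : nmodType) (F : seq T -> V) (w : nat) :
  F [::] = 0 ->
  \sum_(v <- words w) F v =
    \sum_x shift (d x) (fun k => \sum_(y <- words k) F (x :: y)) w.
Proof.
move=> F0; rewrite (bigID (fun v => v == [::])) /=.
rewrite big1 ?add0r => [|v /eqP-> //]; rewrite -big_filter.
(* Without the test, truncated subtraction would allow the empty word after a letter that is too
   heavy. *)
pose t x := if (w < d x)%N then [::] else words (w - d x)%N.
rewrite (perm_big [seq x :: y | x <- enum T, y <- t x]) /=; last first.
  apply: uniq_perm; first by rewrite filter_uniq ?words_uniq.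
    apply: allpairs_uniq_dep => [|x _|]; rewrite ?enum_uniq//.
      by rewrite /t; case: ifP; rewrite ?words_uniq.
    by move=> [x y] [x' y'] _ _ /= [-> ->].
  move=> v; rewrite mem_filter mem_words; apply/andP/allpairsPdep.
    case: v => [|x y] [//= _ /eqP wv]; exists x, y; rewrite mem_enum; split=> //.
    by rewrite /t -wv ltnNge leq_addr /= mem_words addKn.
  move=> [x [y [_ ty ->]]]; split=> //; move: ty; rewrite /t.
  case: ltnP => // xw; rewrite mem_words => /eqP wy.
  by apply/eqP; rewrite /weight /= -/(weight d y) wy subnKC.
rewrite big_allpairs_dep big_enum /=; apply: eq_bigr => x _.
by rewrite /shift /t; case: ifP => // _; rewrite big_nil.
Qed.

Section Avoiding.
Context (a b : T) (ab : a != b).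
Local Notation e := (avoids a b).

Definition linear_count (w : nat) : rat :=
  \sum_(v <- words w) (sorted e v)%:R.

(** With this weighting, the distinct rotations of a power of a primitive word contribute together
    the weight of that primitive word. *)
Definition cyclic_weight (w : nat) : rat :=
  \sum_(v <- words w | path.cycle e v) (d (head a v))%:R.

(** The reciprocal of the generating function of [linear_count], by [linear_count_rec]. *)
Definition walk_poly : {poly rat} :=
  1 - \sum_x 'X^(d x) + 'X^(d a + d b).

Lemma path_avoids_neq (x : T) (y : seq T) : x != a -> path e x y = sorted e y.
Proof. by case: y => //= c y xa; rewrite {1}/avoids (negbTE xa). Qed.

(** As [b] differs from [a], a leading [b] starts no occurrence of the forbidden factor and may
    precede any avoiding word. *)
Lemma count_head_b (w : nat) :
  \sum_(v <- words w) (sorted e v && (ohead v == Some b))%:R =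
  shift (d b) linear_count w.
Proof.
rewrite sum_words_cons// (bigD1 b)//= big1 ?addr0 => [|x xb].
  congr (shift _ _ _); apply/funext => k; apply: eq_bigr => y _.
  by rewrite eqxx andbT path_avoids_neq// eq_sym.
rewrite /shift; case: ifP => // _; apply: big1 => y _.
by rewrite [_ == _](negbTE xb) andbF.
Qed.

(** Reversal turns a condition on the last letter into one on the first, where [sum_words_cons]
    applies; a final [a] never completes the factor [ab]. *)
Lemma count_head_a_rev (w : nat) :
  \sum_(v <- words w) (sorted e (rev v) && (ohead v == Some a))%:R =
  shift (d a) linear_count w.
Proof.
rewrite sum_words_cons ?andbF// (bigD1 a)//= big1 ?addr0 => [|x xa].
  congr (shift _ _ _); apply/funext => k.
  rewrite [RHS]sum_words_rev; apply: eq_bigr => y _.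
  rewrite eqxx andbT rev_cons; case: (rev y) => //= c z.
  by rewrite rcons_path /= [e _ a]/avoids (negbTE ab) andbF andbT.
rewrite /shift; case: ifP => // _; apply: big1 => y _.
by rewrite [_ == _](negbTE xa) andbF.
Qed.

(** Putting [x] before an avoiding word gives an avoiding word unless [x] is [a] and the word begins
    with [b]; the subtracted term removes these exceptions. *)
Lemma count_linear_head (f : T -> rat) (w : nat) :
  \sum_(v <- words w) ((v != [::]) && sorted e v)%:R * f (head a v) =
  \sum_x f x * shift (d x) linear_count w -
    f a * shift (d a + d b) linear_count w.
Proof.
rewrite sum_words_cons ?mul0r//= -shiftD.
(* The correction is spread over all letters, with zero terms away from [a], so that the two sides
   can be compared letter by letter. *)
have -> : f a * shift (d a) (shift (d b) linear_count) w =
    \sum_x (x == a)%:R * (f x * shift (d x) (shift (d b) linear_count) w).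
  rewrite (bigD1 a)//= big1 ?eqxx ?mul1r ?addr0// => x /negbTE->.
  by rewrite mul0r.
rewrite -sumrB; apply: eq_bigr => x _; rewrite /shift.
case: ifP => _; first by rewrite !mulr0 subrr.
rewrite -/(shift _ _ _) -count_head_b !mulr_sumr -sumrB; apply: eq_bigr => y _.
have [->|xa] := eqVneq x a; last by rewrite path_avoids_neq// mul0r subr0 mulrC.
rewrite mul1r -mulrBr mulrC; congr (_ * _).
case: y => [|c y] /=; first by rewrite subr0.
rewrite {1}/avoids eqxx /= -[Some c == _]/(c == b) [LHS]mulrb.
by case: (c == b); case: (path _ _ _); rewrite /= ?subr0 ?subrr.
Qed.

Lemma linear_count_rec (w : nat) :
  linear_count w = (w == 0%N)%:R + \sum_x shift (d x) linear_count w -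
    shift (d a + d b) linear_count w.
Proof.
have := count_linear_head (fun=> 1) w; rewrite mul1r => E.
rewrite -addrA; under eq_bigr do rewrite -[shift _ _ _]mul1r.
rewrite -E /linear_count; under [in RHS]eq_bigr do rewrite mulr1.
apply/eqP; rewrite -subr_eq -sumrB.
have -> : (w == 0%N)%:R = \sum_(v <- words w | v == [::]) (1 : rat).
  case: w {E} => [|w].
    have -> : words 0 = [:: [::]].
      apply: perm_small_eq => //; apply: uniq_perm; rewrite ?words_uniq// => v.
      by rewrite mem_words weight_eq0 inE.
    by rewrite big_cons eqxx big_nil addr0.
  by rewrite big1_seq// => v /andP[/eqP->]; rewrite mem_words.
apply/eqP; rewrite [RHS]big_mkcond; apply: eq_bigr => v _.
by case: v => [|x v] /=; rewrite ?subr0 ?subrr.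
Qed.

(** A nonempty linearly avoiding word fails cyclically exactly when it begins with [b] and ends with
    [a]. Such words have head degree [d b], which gives the [d b] part of the correction; the [d a]
    part comes from [count_linear_head]. *)
Lemma cyclic_weightE (w : nat) : (0 < w)%N ->
  cyclic_weight w = \sum_x (d x)%:R * shift (d x) linear_count w -
    (d a + d b)%:R * shift (d a + d b) linear_count w.
Proof.
move=> w_gt0; rewrite natrD mulrDl opprD addrA -count_linear_head.
(* Removing the leading [b] leaves an avoiding word that ends with [a], counted through its
   reversal. *)
rewrite [shift (d a + d b) _ _](_ : _ = \sum_(v <- words w) (sorted e v &&
    ((ohead v == Some b) && (last b v == a)))%:R); last first.
  rewrite sum_words_cons// (bigD1 b)//= big1 ?addr0 => [|x xb]; last first.
    rewrite /shift; case: ifP => // _; apply: big1 => y _.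
    by rewrite [Some _ == _](negbTE xb) andbF.
  rewrite (addnC (d a)) -shiftD; congr (shift _ _ _).
  apply/funext => k; rewrite -count_head_a_rev.
  rewrite [RHS]sum_words_rev; apply: eq_bigr => y _.
  rewrite eqxx (@path_avoids_neq b) /= 1?[b == a]eq_sym//; congr (_ && _)%:R.
  case: y => [|c y]; first by rewrite /= [b == a]eq_sym (negbTE ab).
  by rewrite rev_cons last_rcons.
rewrite mulr_sumr -sumrB /cyclic_weight big_mkcond.
apply: eq_big_seq => v; rewrite mem_words => /eqP wv.
case: v wv => [w0|x v _] /=; first by move: w_gt0; rewrite -w0.
rewrite rcons_path [e (last _ _) _]/avoids -[Some x == _]/(x == b).
have [->|xb] := eqVneq x b.
  by case: path; case: (_ == a);
     rewrite /= ?mul0r ?mul1r ?mulr0 ?mulr1 ?subr0 ?subrr.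
by rewrite andbF /= !andbF andbT mulr0 subr0; case: path; rewrite ?mul1r ?mul0r.
Qed.

End Avoiding.
End Words.

(** * Coefficients of the logarithm of a polynomial *)

Lemma low_coef_mul (R : comNzRingType) (n : nat) (p s : {poly R}) :
  (forall i, (i < n)%N -> p`_i = 0) -> forall i, (i < n)%N -> (p * s)`_i = 0.
Proof.
move=> p0 i i_lt; rewrite coefM big1// => j _.
by rewrite p0 ?mul0r// (leq_ltn_trans _ i_lt)// -ltnS.
Qed.

Lemma low_coef_exp (R : comNzRingType) (n : nat) (p : {poly R}) :
  p`_0 = 0 -> forall i, (i < n)%N -> (p ^+ n)`_i = 0.
Proof.
move=> p0; elim: n => // n IHn i i_le; rewrite exprS coefM big1// => j _.
case: j => -[|j] j_lt /=; first by rewrite p0 mul0r.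
by rewrite IHn ?mulr0//; lia.
Qed.

(* For [L] the truncation of [log q] at [w] terms, one has
   [q L' = q' (1 - (1 - q)^w)], and [B] is an inverse of [q] modulo [t^w]. *)
Lemma log_coef_deriv (q B : {poly rat}) (w : nat) : (0 < w)%N -> q`_0 = 1 ->
  (forall i, (i < w)%N -> (q * B)`_i = (i == 0%N)%:R) ->
  w%:R * log_coef q w = (q^`() * B)`_w.-1.
Proof.
move=> w_gt0 q0 qB.
pose L := \sum_(1 <= k < w.+1) ((-1) ^+ k.+1 / k%:R) *: (q - 1) ^+ k.
have LE : log_coef q w = L`_w.
  rewrite /log_coef coef_sum; apply: eq_bigr => k _.
  by rewrite coefZ mulrAC.
have dL : L^`() = q^`() * \sum_(i < w) (1 - q) ^+ i.
  rewrite /L raddf_sum /= big_add1 /= big_mkord mulr_sumr; apply: eq_bigr => i _.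
  rewrite derivZ deriv_exp /= derivB derivC subr0.
  rewrite -[q - 1]opprB [(- (1 - q)) ^+ i]exprNn -scalerMnr scalerMnl.
  rewrite -mulr_natr divfK ?pnatr_eq0//.
  rewrite -(signr_odd rat) -(signr_odd {poly rat}) /= negbK.
  by case: odd;
     rewrite ?scaleN1r ?scale1r ?mul1r ?mulN1r ?mulrN ?opprK.
have qdL : q * L^`() = q^`() - q^`() * (1 - q) ^+ w.
  have := subrX1 (1 - q) w; rewrite [1 - q - 1]addrAC subrr add0r mulNr => E.
  by rewrite dL mulrCA -[q * _]opprK -E opprB mulrBr mulr1.
have wL : w%:R * L`_w = L^`()`_w.-1.
  by rewrite coef_deriv prednK// mulr_natl.
have lt_w : (w.-1 < w)%N by rewrite prednK.
have E : q * B * L^`() = q^`() * B - (1 - q) ^+ w * (q^`() * B).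
  by rewrite mulrAC qdL; ring.
have := congr1 (fun p : {poly rat} => p`_w.-1) E; rewrite coefB.
rewrite [X in _ = _ - X](@low_coef_mul _ w)//; last first.
  by apply: low_coef_exp; rewrite coefB q0 coef1 subrr.
rewrite subr0 => <-; rewrite LE wL -[q * B](subrK 1) mulrDl mul1r coefD.
rewrite (@low_coef_mul _ w) ?add0r// => i i_lt.
by rewrite coefB coef1 qB// subrr.
Qed.

Lemma log_coef_walk_poly (T : finType) (d : T -> nat)
    (d_gt0 : forall x, (0 < d x)%N) (a b : T) (ab : a != b) (w : nat) :
  (0 < w)%N ->
  w%:R * log_coef (walk_poly d a b) w = - cyclic_weight d a b w.
Proof.
(* The generating function is truncated to a polynomial; only coefficients up to index [w] are
   used. *)
move=> w_gt0; pose B := \poly_(i < w.+1) linear_count d a b i.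
have XB k i : (i <= w)%N -> ('X^k * B)`_i = shift k (linear_count d a b) i.
  move=> i_le; rewrite coefXnM /shift; case: ltnP => // _.
  by rewrite coef_poly ltnS (leq_trans (leq_subr _ _) i_le).
have qB i : (i <= w)%N -> (walk_poly d a b * B)`_i = (i == 0%N)%:R.
  move=> i_le; rewrite /walk_poly mulrDl mulrBl mul1r coefD coefB XB//.
  rewrite mulr_suml coef_sum; under eq_bigr do rewrite XB//.
  by rewrite coef_poly ltnS i_le [X in X - _ + _]linear_count_rec//; ring.
have q0 : (walk_poly d a b)`_0 = 1.
  rewrite /walk_poly coefD coefB coef1 coefXn coef_sum big1 => [|x _].
    by rewrite eqxx subr0 ltn_eqF ?addn_gt0 ?d_gt0// addr0.
  by rewrite coefXn ltn_eqF.
rewrite (@log_coef_deriv _ B) => // [|i /ltnW]; last exact: qB.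
(* The factor ['X] turns the derivative of ['X^k] into [k] times ['X^k], whose product with [B] is a
   shift. *)
have -> p : (p * B)`_w.-1 = ('X * p * B)`_w :> rat.
  by rewrite -mulrA coefXM eqn0Ngt w_gt0.
rewrite cyclic_weightE// /walk_poly derivD derivB derivC raddf_sum /=.
have dX k : (0 < k)%N -> ('X * ('X^k)^`() * B)`_w =
    k%:R * shift k (linear_count d a b) w.
  case: k => // k _; rewrite derivXn mulrnAr -exprS mulrnAl coefMn XB//.
  by rewrite mulr_natl.
rewrite sub0r mulrDr mulrDl coefD [X in _ + X]dX ?addn_gt0 ?d_gt0//.
rewrite mulrN mulNr coefN mulr_sumr mulr_suml coef_sum.
by rewrite (eq_bigr _ (fun x _ => dX (d x) (d_gt0 x))) opprB addrC.
Qed.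

(** * Counting Lyndon words *)

(** Consecutive copies meet in the same pair of letters as the two ends of [s] when it is closed
    up. *)
Lemma cycle_power (T : Type) (e : rel T) (j : nat) (s : seq T) : (0 < j)%N ->
  path.cycle e (power j s) = path.cycle e s.
Proof.
case: j s => // j [|x p] _; first by elim: j.
rewrite /power /= -/(power j (x :: p)); elim: j => [|j IHj].
  by rewrite cats0.
rewrite /power /= -/(power j (x :: p)) -cat_rcons rcons_cat cat_path last_rcons.
by rewrite IHj andbb.
Qed.

Lemma nth_sum_weight (T : Type) (d : T -> nat) (x0 : T) (s : seq T) :
  (\sum_(i <- iota 0 (size s)) d (nth x0 s i))%N = weight d s.
Proof.
by rewrite /weight sumnE big_map [RHS](big_nth x0) /index_iota subn0.
Qed.

Section LyndonCount.
Context (r : nat) (lt : rel (letter r)) (d : letter r -> nat).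
Context (a b : letter r) (d_gt0 : forall x, (0 < d x)%N).
Context (lt_irr : irreflexive lt) (lt_trans : transitive lt).
Context (lt_total : forall x y, x != y -> lt x y || lt y x) (ab : lt a b).
Local Notation e := (avoids a b).

Definition lyndon_words (w : nat) : seq (seq (letter r)) :=
  [seq l <- words d w | lyndon lt l & sorted e l].

Lemma mem_lyndon_words (w : nat) (l : seq (letter r)) :
  (l \in lyndon_words w) = [&& lyndon lt l, sorted e l & weight d l == w].
Proof. by rewrite mem_filter mem_words// andbA. Qed.

(* A nontrivial Lyndon word ending in [a] does not begin with the larger
   letter [b], so no occurrence of [ab] arises when the word is closed up. *)
Lemma lyndon_cycle (l : seq (letter r)) : lyndon lt l ->
  path.cycle e l = sorted e l.
Proof.
case: l => // x p /(lyndonP lt)[_ lP] /=.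
rewrite rcons_path andb_idr// => _; rewrite /avoids.
apply/negP => /andP[/eqP la /eqP xb]; subst x.
case/lastP: p lP la => [_ /= ba|p y lP]; first by move: ab; rewrite ba lt_irr.
rewrite last_rcons => ya; subst y.
have := lP (size p).+1; rewrite /= size_rcons !ltnS leqnn => /(_ isT).
rewrite -rcons_cons -cats1 [rot _ _](rot_size_cat (b :: p) [:: a]) /=.
case/orP=> [/(lt_trans ab)|/andP[/eqP ba _]]; first by rewrite lt_irr.
by move: ab; rewrite ba lt_irr.
Qed.

Lemma cyclic_weight_lyndon (w : nat) : (0 < w)%N ->
  cyclic_weight d a b w =
  \sum_(k <- divisors w) k%:R * (size (lyndon_words k))%:R.
Proof.
move=> w_gt0.
pose ls := [seq l | k <- divisors w, l <- lyndon_words k].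
(* The exponent is forced by the total weight [w]. *)
pose root_power l := power (w %/ weight d l) l.
have lsP l : l \in ls -> [/\ lyndon lt l, sorted e l,
    (0 < w %/ weight d l)%N, (weight d l %| w)%N & (0 < weight d l)%N].
  move=> /allpairsPdep[k [l' [k_w l_k ->]]]; move: l_k.
  rewrite mem_lyndon_words => /and3P[l_lyndon l_sorted /eqP->].
  rewrite -dvdn_divisors// in k_w.
  by split; rewrite // ?divn_gt0 ?(dvdn_gt0 w_gt0 k_w)// dvdn_leq.
have ls_uniq : uniq ls.
  apply: allpairs_uniq_dep => [|k _|]; first exact: divisors_uniq.
    by rewrite filter_uniq// words_uniq.
  move=> _ _ /allpairsPdep[k [l [_ l_k ->]]] /allpairsPdep[k' [l' [_ l_k' ->]]].
  move: l_k l_k'; rewrite !mem_lyndon_words => /and3P[_ _ /eqP <-].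
  by move=> /and3P[_ _ /eqP <-] /= ->.
have cycles_rot : perm_eq [seq v <- words d w | path.cycle e v]
    [seq rot i (root_power l) | l <- ls, i <- iota 0 (size l)].
  apply: uniq_perm; first by rewrite filter_uniq// words_uniq.
    apply: allpairs_uniq_dep => // [l _|]; first exact: iota_uniq.
    move=> x y /allpairsPdep[l [i [l_ls i_lt ->]]].
    move=> /allpairsPdep[l' [i' [l_ls' i_lt' ->]]] /= eq_rot.
    have [lL _ j_gt0 _ _] := lsP _ l_ls; have [lL' _ j_gt0' _ _] := lsP _ l_ls'.
    rewrite mem_iota in i_lt; rewrite mem_iota in i_lt'.
    by have [-> ->] := rot_lyndon_power_inj lt_irr lt_trans lt_total
      lL lL' j_gt0 j_gt0' i_lt i_lt' eq_rot.
  move=> v; rewrite mem_filter mem_words//; apply/andP/allpairsPdep.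
    move=> [v_cycle /eqP wv].
    have v_neq0 : v != [::] by rewrite -(weight_eq0 d_gt0) wv -lt0n.
    have [l [j [i [lL j_gt0 i_lt v_rot]]]] :=
      exists_lyndon_root lt_irr lt_trans lt_total v_neq0.
    have jl : (j * weight d l)%N = w by rewrite -wv v_rot weight_rot weight_power.
    have wl_gt0 : (0 < weight d l)%N.
      by move: w_gt0; rewrite -jl muln_gt0 => /andP[].
    exists l, i; split.
    - apply/allpairsPdep; exists (weight d l), l; split=> //.
        by rewrite -dvdn_divisors// -jl dvdn_mull.
      rewrite mem_lyndon_words eqxx lL andbT /=.
      by rewrite v_rot rot_cycle cycle_power// lyndon_cycle in v_cycle.
    - by rewrite mem_iota.
    - by rewrite /root_power -jl mulnK.
  move=> [l [i [/lsP[lL l_sorted j_gt0 l_dvd _] _ ->]]].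
  rewrite rot_cycle cycle_power// lyndon_cycle// weight_rot weight_power.
  by rewrite divnK.
rewrite /cyclic_weight -big_filter (perm_big _ cycles_rot) /= big_allpairs_dep.
(* Rotation by [i < size l] brings the [i]-th letter of the root [l] to the front, so the rotations
   attached to [l] contribute the sum of its letter degrees. *)
rewrite [LHS](_ : _ = \sum_(l <- ls) (weight d l)%:R); last first.
  apply: eq_big_seq => l /lsP[_ _ j_gt0 _ _].
  rewrite -(nth_sum_weight _ a) natr_sum; apply: eq_big_seq => i.
  rewrite mem_iota /= => i_lt; congr (d _)%:R.
  rewrite rot_power ?(ltnW i_lt)// /root_power.
  case: (w %/ _)%N j_gt0 => // j _; rewrite /power /= -nth0 nth_cat size_rot.
  rewrite (leq_ltn_trans _ i_lt)// /rot nth_cat size_drop subn_gt0 i_lt.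
  by rewrite nth_drop addn0.
rewrite /ls big_allpairs_dep; apply: eq_bigr => k _.
rewrite -[in RHS]sum1_size natr_sum mulr_sumr.
rewrite big_seq [RHS]big_seq; apply: eq_bigr => l.
by rewrite mem_lyndon_words mulr1 => /and3P[_ _ /eqP->].
Qed.

End LyndonCount.

(** * Möbius inversion *)

Lemma mobius_mul_prime (p j : nat) : prime p -> (0 < j)%N -> ~~ (p %| j)%N ->
  mobius (p * j)%N = - mobius j.
Proof.
move=> p_prime j_gt0 p_j; have p_gt0 := prime_gt0 p_prime.
have pj : perm_eq (primes (p * j)%N) (p :: primes j).
  apply: uniq_perm; rewrite ?primes_uniq//=.
    by rewrite mem_primes (negbTE p_j) !andbF primes_uniq.
  by move=> q; rewrite primesM// primes_prime// !inE.
rewrite /mobius (perm_all _ pj) (perm_size pj) /= lognM// logn_prime// eqxx.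
have -> : logn p j = 0%N by rewrite lognE (negbTE p_j) !andbF.
rewrite addn0 eqxx /= (eq_in_all (a2 := fun q => logn q j == 1%N)).
  by case: ifP => _; rewrite ?oppr0// exprS mulN1r.
move=> q q_j /=; rewrite lognM// logn_prime//.
rewrite [q == p]negbTE//.
by apply: contraTneq q_j => ->; rewrite mem_primes (negbTE p_j) !andbF.
Qed.

Lemma mobius_sqr_dvd (p j : nat) : prime p -> (0 < j)%N -> (p ^ 2 %| j)%N ->
  mobius j = 0.
Proof.
move=> p_prime j_gt0 p2; rewrite /mobius ifF//; apply/negP => /allP/(_ p).
rewrite mem_primes p_prime j_gt0 (dvdn_trans _ p2) ?dvdn_exp// => /(_ isT) /eqP E.
by move: p2; rewrite pfactor_dvdn// E.
Qed.

(** For [n > 1] fix a prime divisor [p]. Divisors divisible by $p^2$ contribute zero, and each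
    divisor [j] prime to [p] cancels against [p * j]. *)
Lemma sum_mobius (n : nat) : (0 < n)%N ->
  \sum_(j <- divisors n) mobius j = (n == 1%N)%:R.
Proof.
move=> n_gt0; case: (ltngtP n 1%N) => [||->]; first by lia.
  move=> n_gt1; pose p := pdiv n; have p_prime : prime p by exact: pdiv_prime.
  have p_gt0 := prime_gt0 p_prime.
  rewrite (bigID (fun j => p %| j)%N) /=.
  rewrite (bigID (fun j => p ^ 2 %| j)%N) /= big1_seq ?add0r; last first.
    move=> j /andP[/andP[_ p2] j_n]; apply: mobius_sqr_dvd p2 => //.
    by move: j_n; rewrite -dvdn_divisors// => /dvdn_gt0->.
  rewrite -big_filter (perm_big [seq (p * j)%N |
      j <- [seq j <- divisors n | ~~ (p %| j)%N]]) /=.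
    rewrite big_map big_filter -big_split big1_seq// => j /andP[p_j j_n] /=.
    rewrite mobius_mul_prime ?addNr//.
    by move: j_n; rewrite -dvdn_divisors// => /dvdn_gt0->.
  apply: uniq_perm; first by rewrite filter_uniq ?divisors_uniq.
    rewrite map_inj_uniq ?filter_uniq ?divisors_uniq// => i j /eqP.
    by rewrite eqn_pmul2l// => /eqP.
  move=> j; rewrite mem_filter -dvdn_divisors//.
  apply/andP/mapP => [[/andP[/dvdnP[i ->] p2] ij_n]|[i]].
    exists i; last by rewrite mulnC.
    rewrite mem_filter -dvdn_divisors// (dvdn_trans (dvdn_mulr _ (dvdnn i)) ij_n).
    by rewrite andbT; apply: contra p2; rewrite expnS expn1 dvdn_pmul2r.
  rewrite mem_filter -dvdn_divisors// => /andP[p_i i_n] ->.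
  rewrite dvdn_mulr// expnS expn1 dvdn_pmul2l// p_i; split=> //.
  by rewrite Gauss_dvd ?prime_coprime// pdiv_dvd.
by rewrite /divisors /= big_seq1 /mobius.
Qed.

(** After substitution for [g], the coefficient of [f k] is the sum of [mobius] over the divisors of
    [n %/ k], which vanishes unless [k = n]. *)
Lemma mobius_inversion (R : comNzRingType) (f g : nat -> R) :
  (forall n, (0 < n)%N -> g n = \sum_(k <- divisors n) f k) ->
  forall n, (0 < n)%N ->
    f n = \sum_(j <- divisors n) (mobius j)%:~R * g (n %/ j)%N.
Proof.
move=> gE n n_gt0.
(* The symmetric condition reads both as [k] dividing [n %/ j] and as [j] dividing [n %/ k], which
   allows the exchange of sums. *)
transitivity (\sum_(j <- divisors n) \sum_(k <- divisors n | (k * j %| n)%N)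
    (mobius j)%:~R * f k).
  rewrite (exchange_big_dep xpredT) //=.
  under eq_bigr do rewrite -mulr_suml.
  rewrite (bigD1_seq n) ?divisors_uniq ?divisors_id//= addrC big1_seq.
    rewrite add0r [X in X * _](_ : _ = 1) ?mul1r//.
    rewrite -big_filter (perm_big [:: 1%N]) ?big_seq1//.
    apply: uniq_perm; rewrite ?filter_uniq ?divisors_uniq// => j.
    rewrite mem_filter -dvdn_divisors// inE -[X in (_ %| X)%N]muln1 dvdn_pmul2l//.
    by rewrite dvdn1; apply: andb_idr => /eqP->; exact: dvd1n.
  move=> k /andP[k_neq k_n]; rewrite -dvdn_divisors// in k_n.
  have k_gt0 := dvdn_gt0 n_gt0 k_n.
  rewrite -big_filter (perm_big (divisors (n %/ k))); last first.
    apply: uniq_perm; rewrite ?filter_uniq ?divisors_uniq// => j.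
    rewrite mem_filter -!dvdn_divisors ?divn_gt0 ?(dvdn_leq n_gt0)//.
    rewrite -{1}(divnK k_n) mulnC dvdn_pmul2r// andb_idr// => /dvdn_trans.
    by apply; rewrite -{2}(divnK k_n) dvdn_mulr.
  rewrite -rmorph_sum sum_mobius ?divn_gt0 ?(dvdn_leq n_gt0)//.
  rewrite (_ : (n %/ k == 1)%N = false) ?mul0r//.
  by apply: contraNF k_neq => /eqP nk; rewrite -(divnK k_n) nk mul1n.
apply: eq_big_seq => j; rewrite -dvdn_divisors// => j_n.
have j_gt0 := dvdn_gt0 n_gt0 j_n.
rewrite gE ?divn_gt0 ?(dvdn_leq n_gt0)// mulr_sumr -big_filter.
apply: perm_big; apply: uniq_perm; rewrite ?filter_uniq ?divisors_uniq// => k.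
rewrite mem_filter -!dvdn_divisors ?divn_gt0 ?(dvdn_leq n_gt0)//.
rewrite -{1}(divnK j_n) dvdn_pmul2r// andb_idr// => /dvdn_trans.
by apply; rewrite -{2}(divnK j_n) dvdn_mulr.
Qed.

(** * From the decomposition to weighted words *)

Lemma weight_standard_bracketing (n r : nat) (lt : rel (letter r))
    (v : seq (letter r)) (b : bracket r) :
  standard_bracketing lt v b ->
  bracket_degree n b = weight (@letter_degree n r) v.
Proof.
elim=> [x|s t bs bt _ _ _ _ IHs _ IHt]; first by rewrite /weight /= addn0.
by rewrite weight_cat /= IHs IHt.
Qed.

Lemma card_set_bij_seq (I : choiceType) (T : choiceType) (A : set I) (s : seq T)
    (f : I -> T) : uniq s -> set_bij A [set` s] f ->
  finite_set A /\ #|` fset_set A|%fset = size s.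
Proof.
move=> s_uniq [fA f_inj f_surj].
have A_s : (A #= `I_(size s))%card.
  rewrite -(card_eql (inj_card_eq f_inj)).
  have -> : f @` A = [set` [fset x in s]%fset].
    rewrite eqEsubset; split=> [_ [x Ax <-]|x].
      by rewrite /= inE; exact: fA.
    by rewrite /= inE; exact: f_surj.
  by apply/card_eq_fsetP; rewrite card_fseq undup_id.
split; last exact: card_fset_set.
by apply/finite_setP; exists (size s).
Qed.

(** There are [r] letters of each of the degrees $n-1$ and $n$, and the forbidden pair has total
    degree $2n-1$. *)
Lemma qpoly_walk (n r : nat) (r_gt0 : (0 < r)%N) : (0 < n)%N ->
  Defs.qpoly n r = walk_poly (@letter_degree n r) (u1 r_gt0) (u1' r_gt0).
Proof.
move=> n_gt0; rewrite /Defs.qpoly /walk_poly big_sumType /= !sumr_const card_ord.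
rewrite !scaler_nat opprD addrA; congr (_ - _ - _ + 'X^ _); lia.
Qed.

Theorem theorem4p9 (R : realType) (n r : nat) (G : finZmodType)
    (M : topologicalType) (x0 : M) (mu : homology R (n + n.+1) M)
    (n_ge2 : (2 <= n)%N) (r_gt0 : (0 < r)%N)
    (M_manifold : closed_manifold R (2 * n).+1 M)
    (M_oriented : generates mu)
    (M_connected : k_connected R n.-1 M)
    (M_homology : additive_iso (homology R n M) ('rV[int]_r * G)%type)
    (D : decomposition x0 r_gt0 G mu) (m : nat) (m_ge2 : (2 <= m)%N) :
  let indices := [set i | dec_index D i /\ dec_height D i = m] in
  finite_set indices /\
  (#|` fset_set indices|%fset)%:R =
    - \sum_(j <- divisors m.-1)
        (mobius j)%:~R * (eta n r (m.-1 %/ j) / j%:R) :> rat.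
Proof.
move=> indices.
pose d := @letter_degree n r; pose a := u1 r_gt0; pose b := u1' r_gt0.
(* The hypothesis $n \ge 2$ makes the degree $n-1$ of the letters [inl i] positive. *)
have d_gt0 x : (0 < d x)%N by case: x => i /=; lia.
have [lt_irr lt_trans lt_total ab _] := dec_order D.
have w_gt0 : (0 < m.-1)%N by lia.
have height i : dec_index D i ->
    dec_height D i = (weight d (dec_word D i)).+1.
  by move=> /(dec_standard (d := D)) /(weight_standard_bracketing n) <-.
have [word_fun word_inj word_surj] := dec_listing D.
have bij : set_bij indices [set` lyndon_words (dec_lt D) d a b m.-1] (dec_word D).
  split.
  - move=> i [iD /esym]; rewrite height// => ->.
    rewrite /= mem_lyndon_words// eqxx andbT sorted_avoids.
    by have [-> ->] := word_fun i iD.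
  - by move=> i j; rewrite !inE => -[iD _] [jD _]; apply: word_inj; rewrite inE.
  - move=> l; rewrite /= mem_lyndon_words// sorted_avoids.
    move=> /and3P[lL l_av /eqP wl].
    have [i iD il] := word_surj l (conj lL l_av).
    by exists i => //; split=> //; rewrite height// il wl prednK// ltnW.
have lw_uniq : uniq (lyndon_words (dec_lt D) d a b m.-1).
  by rewrite filter_uniq// words_uniq.
have [fin card] := card_set_bij_seq lw_uniq bij.
split=> //; rewrite card {indices bij fin card lw_uniq}.
set w := m.-1 in w_gt0 *.
pose l k : rat := (size (lyndon_words (dec_lt D) d a b k))%:R.
have inv k : (0 < k)%N ->
    - (k%:R * eta n r k) = \sum_(i <- divisors k) i%:R * l i.
  move=> k_gt0; rewrite /eta (qpoly_walk r_gt0) ?(ltnW n_ge2)//.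
  rewrite log_coef_walk_poly// opprK; exact: cyclic_weight_lyndon.
have w_neq0 : w%:R != 0 :> rat by rewrite pnatr_eq0 -lt0n.
(* The relation [inv] involves [k * l k], so inversion yields [w * l w]. In the term of [j], the
   factor [w] divided by [j] is the [w %/ j] that multiplies [eta]. *)
apply: (mulfI w_neq0); rewrite -/(l w).
rewrite (mobius_inversion inv)// mulrN mulr_sumr -sumrN.
apply: eq_big_seq => j; rewrite -dvdn_divisors// => j_w.
have j_neq0 : j%:R != 0 :> rat by rewrite pnatr_eq0 -lt0n (dvdn_gt0 w_gt0).
have -> : w%:R = (w %/ j)%:R * j%:R :> rat by rewrite -natrM divnK.
by rewrite mulrN; field.
Qed.
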